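(* For all integers $n \ge 4$, $$\left\lceil \frac{2n-6}{3} \right\rceil \ge h(n) \ge \frac{4n-10}{7}.$$
   Context: A tournament is an orientation of a complete graph (finite and simple). For a directed path $v_1 v_2 \cdots v_m$ in a tournament, a hop is an edge $v_i v_{i+2}$ of the tournament, directed from $v_i$ to $v_{i+2}$. Let $h(n)$ denote the largest integer such that every tournament with $n$ vertices has a (directed) Hamiltonian path with at least $h(n)$ hops. *)

(* Defs.v *)
From mathcomp Require Import all_boot all_order all_algebra.
From mathcomp Require Import boolp.

Set Implicit Arguments.
Unset Strict Implicit.
Unset Printing Implicit Defensive.

Definition tournament (T : finType) (e : rel T) : Prop :=
  irreflexive e /\ forall x y, x != y -> e x y (+) e y x.

Definition hamiltonian_path (T : finType) (e : rel T) (s : seq T) : Prop :=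
  [/\ sorted e s, uniq s & forall x, x \in s].

(* [zip s (drop 2 s)] lists the pairs (v_i, v_{i+2}). *)
Definition hops (T : finType) (e : rel T) (s : seq T) : nat :=
  count (fun p => e p.1 p.2) (zip s (drop 2 s)).

Definition guaranteed (n k : nat) : Prop :=
  forall (T : finType) (e : rel T), #|T| = n -> tournament e ->
    exists2 s, hamiltonian_path e s & k <= hops e s.

Lemma hops_le_size (T : finType) (e : rel T) (s : seq T) :
  hops e s <= size s.
Proof.
by rewrite (leq_trans (count_size _ _)) // size_zip geq_minl.
Qed.

(* Redei *)
Lemma hamiltonian_path_ex (T : finType) (e : rel T) :
  tournament e -> exists s, hamiltonian_path e s.
Proof.
move=> [_ tot_e]; pose e' := [rel x y | (x == y) || e x y].
have tot_e' : total e'.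
  move=> x y /=; case: (eqVneq x y) => [->|/tot_e] //=.
  by case: (e x y) => //= ->; rewrite orbT.
exists (sort e' (enum T)); split; last by move=> x; rewrite mem_sort mem_enum.
- have := sort_sorted tot_e' (enum T).
  have : uniq (sort e' (enum T)) by rewrite sort_uniq enum_uniq.
  case: (sort _ _) => //= x s; elim: s x => //= y s IHs x.
  rewrite inE negb_or => /andP[/andP[/negPf-> _] us] /andP[/= -> ps].
  exact: IHs.
- by rewrite sort_uniq enum_uniq.
Qed.

Lemma guaranteed_ex (n : nat) : exists k, `[< guaranteed n k >].
Proof.
exists 0; apply/asboolP => T e _ /hamiltonian_path_ex[s sP].
by exists s.
Qed.

Lemma guaranteed_le (n k : nat) : `[< guaranteed n k >] -> k <= n.
Proof.
move=> /asboolP /(_ 'I_n (fun i j => i < j) (card_ord n)) [].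
  split=> [i|i j]; first exact: ltnn.
  by rewrite -val_eqE /=; case: ltngtP.
move=> s [_ us ms] /leq_trans; apply; rewrite (leq_trans (hops_le_size _ _)) //.
by rewrite -(card_uniqP us) -[leqRHS]card_ord max_card.
Qed.

Definition hop_number (n : nat) : nat := ex_maxn (guaranteed_ex n) (@guaranteed_le n).

Lemma hop_number_guaranteed (n : nat) : guaranteed n (hop_number n).
Proof. by rewrite /hop_number; case: ex_maxnP => k /asboolP. Qed.

Lemma hop_number_max (n k : nat) : guaranteed n k -> k <= hop_number n.
Proof. by rewrite /hop_number; case: ex_maxnP => m _ mP gk; apply/mP/asboolP. Qed.

(* Main.v *)
Require Import Defs.
From mathcomp Require Import all_boot all_order all_algebra.
From mathcomp Require Import boolp zify lra.

(** The upper bound comes from a linear chain of cyclic triangles, each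
    dominating all the later ones (the last block may be incomplete).  A
    Hamiltonian path has to run through the blocks in order, three consecutive
    vertices of a path inside one cyclic triangle never carry a hop, and
    n - 2 - n %/ 3 is the number of remaining places for hops
    ([hops_triangle_chain]).

    For the lower bound, pick a vertex v with a in-neighbours and b
    out-neighbours, and join Hamiltonian paths P of the former and Q of the
    latter into P v Q.  The hops of P and Q survive; there is a new hop from the
    last vertex but one of P to v and another from v to the second vertex of Q;
    and there is one more if the last vertex of P dominates the first vertex of
    Q ([traceable_join_arc]).  With f m = (4 m - 10) / 7 this gives exactly
    f a + f b + 2 = f (a + b + 1), so that induction would conclude, were it not
    for the degrees 1, where only one of the two sides yields a new hop, and 3,
    where a cyclic triangle falls short of f 3 > 0.

    From 15 vertices on, some vertex avoids these degrees: at most 7 vertices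
    have out-degree at most 3 ([card_low_out]), and likewise for the in-degree,
    so that some v has both degrees at least 4.  On fewer vertices, integrality
    makes any v suitable except on 5, 7, 8 and 10 vertices.  There, if the bound
    fails, all degrees are restricted and every neighbourhood of size 3 is a
    cyclic triangle, which is contradictory.  On 5 vertices all out-degrees are
    odd, against their sum being 10.  On 7 vertices the tournament is regular
    and the extra hop of the join is available, since the paths of the two
    triangles may be rotated.  On 8 and 10 vertices, when the in-neighbourhood
    of v is a triangle, the unavailability of the extra hop forces the first
    vertex w of Q to dominate that triangle, and then the in-neighbourhood of w
    cannot be a triangle ([triangle_in_exchange]); this closes 10 vertices at
    once and leads to a count of low degrees on 8 vertices
    ([card_in13_card8]). *)

Set Implicit Arguments.
Unset Strict Implicit.
Unset Printing Implicit Defensive.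

Definition transpose (T : finType) (e : rel T) : rel T := fun x y => e y x.

Definition out_nbrs (T : finType) (e : rel T) (A : {set T}) (v : T) : {set T} :=
  [set x in A | e v x].

Definition in_nbrs (T : finType) (e : rel T) (A : {set T}) (v : T) : {set T} :=
  [set x in A | e x v].

(** Subtournaments are represented by vertex sets, so that the induction on
    the number of vertices stays within one tournament. *)
Definition spans (T : finType) (e : rel T) (A : {set T}) (s : seq T) : Prop :=
  [/\ sorted e s, uniq s & s =i A].

Definition traceable (T : finType) (e : rel T) (A : {set T}) (k : nat) : Prop :=
  exists2 s, spans e A s & k <= hops e s.

(** * Degrees in a tournament *)

Section Degrees.

Variables (T : finType) (e : rel T).
Hypothesis te : tournament e.

Lemma arc_irrefl x : e x x = false.
Proof. by case: te => ->. Qed.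

Lemma arc_total x y : x != y -> e x y || e y x.
Proof. by case: te => _ /(_ x y) h /h; case: (e x y). Qed.

Lemma arc_asym x y : e x y -> e y x = false.
Proof.
move=> exy; have nxy : x != y.
  by apply: contraTneq exy => ->; rewrite arc_irrefl.
by case: te => _ /(_ x y nxy); rewrite exy; case: (e y x).
Qed.

Lemma arc_neq x y : e x y -> x != y.
Proof. by apply: contraTneq => ->; rewrite arc_irrefl. Qed.

Lemma tournament_transpose : tournament (transpose e).
Proof.
case: te => ir tot; split=> [x|x y nxy]; first exact: ir.
by rewrite /transpose addbC; apply: tot.
Qed.

Lemma card_in_out (A : {set T}) v :
  v \in A -> #|in_nbrs e A v| + #|out_nbrs e A v| = #|A|.-1.
Proof.
move=> vA; rewrite (cardsD1 v A) vA add1n -pred_Sn.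
rewrite -(cardsID [set x | e x v] (A :\ v)).
congr (_ + _); apply: eq_card => x; rewrite !inE.
  by case: eqP => [->|//]; rewrite arc_irrefl andbF.
case: (eqVneq x v) => [->|/= nxv]; first by rewrite arc_irrefl !andbF.
case: (boolP (e x v)) => [/arc_asym->|nexv] /=; first by rewrite andbF.
by have := arc_total nxv; rewrite (negPf nexv) orFb => ->; rewrite andbT.
Qed.

Lemma sum_out_nbrs (A : {set T}) :
  (\sum_(v in A) #|out_nbrs e A v|) * 2 = #|A| * #|A|.-1.
Proof.
have eq_sums :
    \sum_(v in A) #|out_nbrs e A v| = \sum_(v in A) #|in_nbrs e A v|.
  (* both sums count the arcs, at their tails and at their heads *)
  transitivity (\sum_(v in A) \sum_(x in A) e v x).
    apply: eq_bigr => v _; rewrite -sum1dep_card big_mkcondr.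
    by apply: eq_bigr => x _; case: (e v x).
  rewrite exchange_big; apply: eq_bigr => v _ /=.
  rewrite -sum1dep_card big_mkcondr.
  by apply: eq_bigr => x _; case: (e x v).
rewrite muln2 -addnn {1}eq_sums -big_split -sum_nat_const /=.
by apply: eq_bigr => v /card_in_out.
Qed.

(** The out-degrees inside D already average (#|D| - 1) / 2. *)
Lemma card_low_out (A D : {set T}) d :
    D \subset A -> (forall v, v \in D -> #|out_nbrs e A v| <= d) ->
  #|D| <= d.*2.+1.
Proof.
move=> sDA lowD; have := sum_out_nbrs D.
have : \sum_(v in D) #|out_nbrs e D v| <= \sum_(v in D) d.
  apply: leq_sum => v vD; apply: leq_trans (lowD v vD).
  apply/subset_leq_card/subsetP => x.
  by rewrite !inE => /andP[/(subsetP sDA)-> ->].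
rewrite sum_nat_const; move: (\sum_(v in D) _) => m; case: #|D| => //= c; nia.
Qed.

End Degrees.

(** * Hops of sequences *)

Section Hops.

Variables (T : finType) (e : rel T).

Lemma hops_cons3 x y z s :
  hops e [:: x, y, z & s] = e x z + hops e [:: y, z & s].
Proof. by rewrite /hops /= !drop0. Qed.

Lemma hops_rcons2 s x y z :
  hops e (s ++ [:: x; y; z]) = hops e (s ++ [:: x; y]) + e x z.
Proof.
elim: s => [|a [|b [|c s]] IHs]; try by rewrite /hops /= ?addn0 ?addnA.
by rewrite !cat_cons !hops_cons3 -!cat_cons IHs addnA.
Qed.

(** Three pairs at distance two straddle the junction: the last vertex but one
    of s1 with v, v with the second vertex of s2, and the last vertex of s1 with
    the first one of s2.  The first two are arcs as soon as they exist; the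
    third one is a matter of choosing s1 and s2. *)
Lemma hops_join (s1 s2 : seq T) v :
    (forall x, x \in s1 -> e x v) -> (forall y, y \in s2 -> e v y) ->
  hops e s1 + hops e s2 + (1 < size s1) + (1 < size s2)
    + [&& s1 != [::], s2 != [::] & e (last v s1) (head v s2)]
  <= hops e (s1 ++ v :: s2).
Proof.
move=> + outs2; elim: s1 => [|x [|x' s1] IHs1] ins1.
- case: s2 outs2 => [|y [|z s]] outs2 //=.
  by rewrite hops_cons3 outs2 ?inE ?eqxx ?orbT //= /hops /=; lia.
- have {IHs1} /IHs1 : forall x, x \in [::] -> e x v by [].
  case: s2 outs2 => [|y s] outs2 //= IHs1.
  rewrite hops_cons3; move: IHs1; rewrite /= /hops /=; lia.
have {IHs1}IHs1 := IHs1 (fun y ys => ins1 y (mem_behead (s := x :: _) ys)).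
case: s1 => [|x'' s1] in ins1 IHs1 *; rewrite /= hops_cons3.
  by rewrite ins1 ?inE ?eqxx //; move: IHs1 => /=; rewrite /hops /=; lia.
by move: IHs1 => /=; rewrite hops_cons3; lia.
Qed.

End Hops.

Lemma hops_rev (T : finType) (e : rel T) s :
  hops e (rev s) = hops (transpose e) s.
Proof.
elim: s => [|x [|y [|z s]] IHs] //.
by rewrite hops_cons3 -IHs !rev_cons -!cats1 -!catA /= hops_rcons2 addnC.
Qed.

(** * Joining paths at a vertex *)

Section Joining.

Variables (T : finType) (e : rel T).
Hypothesis te : tournament e.
Implicit Types A : {set T}.

Lemma traceable_weaken A k l : k <= l -> traceable e A l -> traceable e A k.
Proof. by move=> kl [s sA hs]; exists s => //; apply: leq_trans hs. Qed.

Lemma traceable_transpose A k : traceable (transpose e) A k -> traceable e A k.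
Proof.
case=> s [ss us sA] hs; exists (rev s); last by rewrite hops_rev.
by split; rewrite ?rev_sorted ?rev_uniq // => x; rewrite mem_rev.
Qed.

Lemma size_spans A s : spans e A s -> size s = #|A|.
Proof. by case=> _ us sA; rewrite -(card_uniqP us); apply: eq_card. Qed.

Lemma spans_join A v s1 s2 :
    v \in A -> spans e (in_nbrs e A v) s1 -> spans e (out_nbrs e A v) s2 ->
  spans e A (s1 ++ v :: s2).
Proof.
move=> vA [ss1 us1 s1A] [ss2 us2 s2A].
have sv2 : path e v s2.
  case: s2 ss2 s2A {us2} => //= y s -> s2A.
  by have := s2A y; rewrite !inE eqxx /= => /esym/andP[_ ->].
split.
- case: s1 ss1 s1A {us1} => //= x s sxs s1A; rewrite cat_path sxs /= sv2 andbT.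
  by have := s1A (last x s); rewrite mem_last inE => /esym/andP[].
- rewrite cat_uniq us1 /= us2 andbT s2A !inE (arc_irrefl te) andbF andbT.
  rewrite negb_or s1A !inE (arc_irrefl te) andbF /=.
  apply/hasPn => x.
  by rewrite s2A s1A !inE => /andP[_ /(arc_asym te)->]; rewrite andbF.
move=> x; rewrite mem_cat inE s1A s2A !inE.
case: (eqVneq x v) => [->|nxv]; first by rewrite vA orbT.
by rewrite -andb_orr (arc_total te nxv) andbT.
Qed.

Lemma traceable_join_arc A v s1 s2 :
    v \in A -> spans e (in_nbrs e A v) s1 -> spans e (out_nbrs e A v) s2 ->
  traceable e A (hops e s1 + hops e s2
    + (1 < #|in_nbrs e A v|) + (1 < #|out_nbrs e A v|)
    + [&& s1 != [::], s2 != [::] & e (last v s1) (head v s2)]).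
Proof.
move=> vA sp1 sp2; exists (s1 ++ v :: s2); first exact: spans_join.
rewrite -(size_spans sp1) -(size_spans sp2); apply: hops_join => x.
  by case: sp1 => _ _ ->; rewrite inE => /andP[].
by case: sp2 => _ _ ->; rewrite inE => /andP[].
Qed.

Lemma traceable_join A v k l :
    v \in A ->
    traceable e (in_nbrs e A v) k -> traceable e (out_nbrs e A v) l ->
  traceable e A (k + l + (1 < #|in_nbrs e A v|) + (1 < #|out_nbrs e A v|)).
Proof.
move=> vA [s1 sp1 h1] [s2 sp2 h2].
apply: traceable_weaken (traceable_join_arc vA sp1 sp2); lia.
Qed.

Lemma traceable0 A : traceable e A 0.
Proof.
have [n] := ubnP #|A|; elim: n A => // n IHn A.
case: (set_0Vmem A) => [-> _|[v vA] ltAn].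
  by exists [::] => //; split=> // x; rewrite inE.
have /= cA := card_in_out te vA.
have A0 : 0 < #|A| by apply/card_gt0P; exists v.
by apply: traceable_weaken (traceable_join vA (IHn _ _) (IHn _ _)) => //; lia.
Qed.

End Joining.

(** * Cyclic triangles *)

(** Three vertices fail to be traceable with a hop exactly when they form a
    cyclic triangle, and cyclic triangles are expressed in this way below: a
    vertex v dominating the two others would start a path with a hop. *)
Lemma triangle_in_arc (T : finType) (e : rel T) (B : {set T}) v :
    tournament e -> #|B| = 3 -> ~ traceable e B 1 -> v \in B ->
  exists2 y, y \in B & e y v.
Proof.
move=> te B3 ntB vB; have cB := card_in_out te vB.
case: (set_0Vmem (in_nbrs e B v)) => [in0|[y]]; last first.
  by rewrite inE => /andP[yB eyv]; exists y.
case: ntB; have := traceable_join te vB (traceable0 te _) (traceable0 te _).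
apply: traceable_weaken.
by move: cB; rewrite B3 in0 cards0 add0n => ->.
Qed.

(** Following the arcs of a cyclic triangle from any vertex gives a path. *)
Lemma triangle_spans_head (T : finType) (e : rel T) (B : {set T}) x :
    tournament e -> #|B| = 3 -> ~ traceable e B 1 -> x \in B ->
  exists s, spans e B (x :: s).
Proof.
move=> te B3 ntB.
have out_arc v : v \in B -> exists2 y, y \in B & e v y.
  apply: (triangle_in_arc (tournament_transpose te)) => //.
  by move=> ?; apply: ntB; apply: traceable_transpose.
move=> xB; have [y yB exy] := out_arc x xB; have [z zB eyz] := out_arc y yB.
have us : uniq [:: x; y; z].
  rewrite /= !inE negb_or (arc_neq te exy) (arc_neq te eyz) andbT /= andbT.
  by apply: contraTneq eyz => <-; rewrite (arc_asym te exy).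
have sB : {subset [:: x; y; z] <= enum B}.
  by move=> t; rewrite mem_enum !inE => /or3P[] /eqP->.
have [|_ eqB] := uniq_min_size us sB; first by rewrite -cardE B3.
exists [:: y; z]; split=> [|//|t]; first by rewrite /= exy eyz.
by rewrite eqB mem_enum.
Qed.

Lemma triangle_spans_last (T : finType) (e : rel T) (B : {set T}) x :
    tournament e -> #|B| = 3 -> ~ traceable e B 1 -> x \in B ->
  exists s, spans e B (rcons s x).
Proof.
move=> te B3 ntB xB.
have [|s [ss us sB]] := triangle_spans_head (tournament_transpose te) B3 _ xB.
  by move=> ?; apply: ntB; apply: traceable_transpose.
exists (rev s); rewrite -rev_cons; split; rewrite ?rev_sorted ?rev_uniq //.
by move=> t; rewrite mem_rev.
Qed.

(** * The induction step *)

(** For positive n this is the ceiling of (4 n - 10) / 7, except at 3, where the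
    cyclic triangle has no hop. *)
Definition hop_bound (n : nat) : nat := if n == 3 then 0 else (4 * n.-1) %/ 7.

Definition traceable_below (T : finType) (e : rel T) (A : {set T}) : Prop :=
  forall B : {set T}, #|B| < #|A| -> traceable e B (hop_bound #|B|).

Section Steps.

Variables (T : finType) (e : rel T) (A : {set T}).
Hypotheses (te : tournament e) (IH : traceable_below e A).

Lemma traceable_in v :
  v \in A -> traceable e (in_nbrs e A v) (hop_bound #|in_nbrs e A v|).
Proof.
move=> vA; apply: IH; have := card_in_out te vA.
have : 0 < #|A| by apply/card_gt0P; exists v.
lia.
Qed.

Lemma traceable_out v :
  v \in A -> traceable e (out_nbrs e A v) (hop_bound #|out_nbrs e A v|).
Proof.
move=> vA; apply: IH; have := card_in_out te vA.
have : 0 < #|A| by apply/card_gt0P; exists v.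
lia.
Qed.

Lemma traceable_step v : v \in A ->
  traceable e A (hop_bound #|in_nbrs e A v| + hop_bound #|out_nbrs e A v|
    + (1 < #|in_nbrs e A v|) + (1 < #|out_nbrs e A v|)).
Proof.
move=> vA; apply: (traceable_join te) => //.
  exact: traceable_in.
exact: traceable_out.
Qed.

(** Let w be the first vertex of a path with l hops on the out-neighbours of v.
    An arc to w from the triangle of in-neighbours of v would give the extra hop
    of the join, as the path on the triangle can end at any vertex: l + 3 hops
    in total.  So w dominates that triangle as well as the second vertex of its
    path.  The in-neighbours of w are then v and out-neighbours of v; as v
    dominates the others, they do not form a cyclic triangle. *)
Lemma triangle_in_exchange v l :
    v \in A -> #|in_nbrs e A v| = 3 -> ~ traceable e (in_nbrs e A v) 1 ->
    1 < #|out_nbrs e A v| -> traceable e (out_nbrs e A v) l ->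
    ~ traceable e A (l + 3) ->
  exists w, [/\ w \in out_nbrs e A v, 3 < #|out_nbrs e A w|
             & #|in_nbrs e A w| = 3 -> traceable e (in_nbrs e A w) 1].
Proof.
move=> vA in3 ntin out1 [s2 sp2 h2] ntA.
have := size_spans sp2.
case: s2 sp2 h2 => [|w [|y s]] sp2 h2 sz2; try by rewrite -sz2 in out1.
have [/= /andP[ewy _] _ s2A] := sp2; have wout : w \in out_nbrs e A v.
  by rewrite -s2A mem_head.
have [wA evw] : w \in A /\ e v w by move: wout; rewrite inE => /andP.
have yout : y \in out_nbrs e A v by rewrite -s2A !inE eqxx orbT.
have in_w x : x \in in_nbrs e A v -> e w x.
  move=> xin; have nwx : w != x.
    by apply: contraTneq xin => <-; rewrite inE (arc_asym te evw) andbF.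
  case/orP: (arc_total te nwx) => // exw; case: ntA.
  have [s1 sp1] := triangle_spans_last te in3 ntin xin.
  apply: traceable_weaken (traceable_join_arc te vA sp1 sp2).
  rewrite in3 out1 last_rcons /= exw -size_eq0 size_rcons; lia.
exists w; split=> //.
  have /subset_leq_card : y |: in_nbrs e A v \subset out_nbrs e A w.
    apply/subsetP => x /setU1P[->|xin].
      by move: yout; rewrite !inE ewy => /andP[->].
    by rewrite inE in_w // andbT; move: xin; rewrite inE => /andP[].
  apply: leq_trans; rewrite cardsU1 in3.
  by move: yout; rewrite !inE => /andP[_ /(arc_asym te)->]; rewrite andbF.
move=> inw3; apply: contrapT => ntinw.
have vinw : v \in in_nbrs e A w by rewrite inE vA.
have [u + euv] := triangle_in_arc te inw3 ntinw vinw.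
rewrite inE => /andP[uA euw]; have := in_w u; rewrite inE uA euv => /(_ isT).
by rewrite (arc_asym te euw).
Qed.

End Steps.

Lemma traceable_below_transpose (T : finType) (e : rel T) (A : {set T}) :
  traceable_below e A -> traceable_below (transpose e) A.
Proof. by move=> IH B /IH; apply: (@traceable_transpose _ (transpose e)). Qed.

(** * Tournaments on 5, 7, 10 and 8 vertices *)

(** Unless the join at some vertex suffices, all out-degrees are 1 or 3, and
    five odd numbers do not add up to 10. *)
Lemma traceable_card5 (T : finType) (e : rel T) (A : {set T}) :
  tournament e -> traceable_below e A -> #|A| = 5 -> traceable e A 2.
Proof.
move=> te IH A5; apply: contrapT => ntA.
have odd_out v : v \in A -> #|out_nbrs e A v| = 1 + #|out_nbrs e A v|./2 * 2.
  move=> vA; have := traceable_step te IH vA; have := card_in_out te vA.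
  rewrite A5; move: #|in_nbrs e A v| #|out_nbrs e A v| => a b ab.
  have: b < 5 by lia.
  have -> : a = 4 - b by lia.
  (* the even out-degrees 0, 2 and 4 make the join suffice *)
  by move: b {ab} => [|[|[|[|[|b]]]]] //= _;
    rewrite /hop_bound /= => /ntA.
have := sum_out_nbrs te A.
by rewrite (eq_bigr _ odd_out) big_split /= sum_nat_const -big_distrl A5 /=; lia.
Qed.

(** Unless the join at some vertex suffices, the tournament is regular with
    cyclic in- and out-neighbourhoods.  An in-neighbour x of v has only one
    out-neighbour in its triangle; together with v these are two, and the third
    one, y, is an out-neighbour of v.  The arc from x to y is the extra hop. *)
Lemma traceable_card7 (T : finType) (e : rel T) (A : {set T}) :
  tournament e -> traceable_below e A -> #|A| = 7 -> traceable e A 3.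
Proof.
move=> te IH A7; apply: contrapT => ntA.
have deg v : v \in A -> #|in_nbrs e A v| = 3 /\ #|out_nbrs e A v| = 3.
  move=> vA; have := traceable_step te IH vA; have := card_in_out te vA.
  rewrite A7; move: #|in_nbrs e A v| #|out_nbrs e A v| => a b ab.
  have: b < 7 by lia.
  have -> : a = 6 - b by lia.
  by move: b {ab} => [|[|[|[|[|[|[|b]]]]]]] //= _;
    rewrite /hop_bound /= => /ntA.
have [v vA] : exists v, v \in A by apply/card_gt0P; rewrite A7.
have [in3 out3] := deg v vA.
have ntin : ~ traceable e (in_nbrs e A v) 1.
  move=> tin; apply: ntA; have := traceable_join te vA tin (traceable0 te _).
  by rewrite in3 out3.
have ntout : ~ traceable e (out_nbrs e A v) 1.
  move=> tout; apply: ntA; have := traceable_join te vA (traceable0 te _) tout.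
  by rewrite in3 out3.
have [x xin] : exists x, x \in in_nbrs e A v by apply/card_gt0P; rewrite in3.
have [z zin ezx] := triangle_in_arc te in3 ntin xin.
have xA : x \in A by move: xin; rewrite inE => /andP[].
have [y yout exy] : exists2 y, y \in out_nbrs e A v & e x y.
  apply: contrapT => noy; have [_ outx3] := deg x xA.
  have /subset_leq_card : out_nbrs e A x \subset v |: (in_nbrs e A v :\ x :\ z).
    apply/subsetP => y; rewrite !inE => /andP[yA exy].
    case: eqVneq => //= nyv; rewrite yA (eq_sym y x) (arc_neq te exy) /=.
    apply/andP; split.
      by apply: contraTneq exy => ->; rewrite (arc_asym te ezx).
    case/orP: (arc_total te nyv) => // evy.
    by case: noy; exists y; rewrite // inE yA.
  have /= := cardsD1 x (in_nbrs e A v); have := cardsD1 z (in_nbrs e A v :\ x).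
  rewrite cardsU1 outx3 in3 xin in_setD1 zin (arc_neq te ezx) /= !inE.
  by case: (~~ _) => /=; lia.
have [s1 sp1] := triangle_spans_last te in3 ntin xin.
have [s2 sp2] := triangle_spans_head te out3 ntout yout.
apply: ntA; apply: traceable_weaken (traceable_join_arc te vA sp1 sp2).
by rewrite in3 out3 last_rcons /= exy -size_eq0 size_rcons; lia.
Qed.

(** If the bound fails, all degrees are 3 or 6 and in-neighbourhoods of size 3
    are cyclic triangles.  The vertex w exchanged for v has out-degree above 3,
    so its in-degree is 3, but its in-neighbours are not a cyclic triangle. *)
Lemma traceable_card10_in3 (T : finType) (e : rel T) (A : {set T}) v :
    tournament e -> traceable_below e A -> #|A| = 10 -> v \in A ->
  #|in_nbrs e A v| = 3 -> traceable e A 5.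
Proof.
move=> te IH A10 vA in3; apply: contrapT => ntA.
have out6 : #|out_nbrs e A v| = 6.
  by have := card_in_out te vA; rewrite A10 in3 /=; lia.
have tout := traceable_out te IH vA; rewrite out6 in tout.
have ntri u :
    u \in A -> #|in_nbrs e A u| = 3 -> ~ traceable e (in_nbrs e A u) 1.
  move=> uA inu3 tin; apply: ntA.
  apply: traceable_weaken (traceable_join te uA tin (traceable_out te IH uA)).
  have := card_in_out te uA; rewrite A10 inu3 /= => outu.
  by have -> : #|out_nbrs e A u| = 6 by lia.
have [||w [wout outw inw]] :=
    triangle_in_exchange te vA in3 (ntri v vA in3) _ tout.
- by rewrite out6.
- by [].
have wA : w \in A by move: wout; rewrite inE => /andP[].
(* a join at w suffices for all its remaining degrees *)
have := traceable_step te IH wA; have := card_in_out te wA; rewrite A10.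
move: inw (ntri w wA) outw.
move: #|in_nbrs e A w| #|out_nbrs e A w| => a b inw nin bgt ab.
have : b < 10 by lia.
have ea : a = 9 - b by lia.
have na3 : a <> 3 by move=> a3; apply: nin => //; apply: inw.
rewrite ea; move: b {ab inw nin} bgt ea.
by move=> [|[|[|[|[|[|[|[|[|[|b]]]]]]]]]] //= _ ea _;
    rewrite /hop_bound => /ntA.
Qed.

Lemma traceable_card10 (T : finType) (e : rel T) (A : {set T}) :
  tournament e -> traceable_below e A -> #|A| = 10 -> traceable e A 5.
Proof.
move=> te IH A10.
have [v vA] : exists v, v \in A by apply/card_gt0P; rewrite A10.
have [in3|nin3] := eqVneq #|in_nbrs e A v| 3.
  exact: traceable_card10_in3 in3.
have [out3|nout3] := eqVneq #|out_nbrs e A v| 3.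
  apply: traceable_transpose.
  have IH' := traceable_below_transpose IH.
  exact: traceable_card10_in3 (tournament_transpose te) IH' A10 vA out3.
have := card_in_out te vA; have := traceable_step te IH vA; rewrite A10.
move: #|in_nbrs e A v| #|out_nbrs e A v| nin3 nout3 => a b na nb tA ab.
apply: traceable_weaken tA; have -> : a = 9 - b by lia.
have : b < 10 by lia.
have : b <> 6 by lia.
by move: b nb {ab} => [|[|[|[|[|[|[|[|[|[|b]]]]]]]]]].
Qed.

(** A vertex v of in-degree 3 is the only in-neighbour of some vertex w, by the
    exchange for triangles.  Such a w dominates all vertices but v, so that any
    further vertex of in-degree 1 has w as its only in-neighbour: there is at
    most one.  A second vertex of in-degree 3 would in the same way be the only
    in-neighbour of some vertex other than w, but w dominates that one.  This
    leaves v, w and at most one more vertex. *)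
Lemma card_in13_card8 (T : finType) (e : rel T) (A : {set T}) :
    tournament e -> traceable_below e A -> #|A| = 8 -> ~ traceable e A 4 ->
  #|[set v in A | #|in_nbrs e A v| \in [:: 1; 3]]| <= 3.
Proof.
move=> te IH A8 ntA; set C := [set v in A | _].
have ntri u :
    u \in A -> #|in_nbrs e A u| = 3 -> ~ traceable e (in_nbrs e A u) 1.
  move=> uA inu3 tin; apply: ntA.
  apply: traceable_weaken (traceable_join te uA tin (traceable_out te IH uA)).
  have := card_in_out te uA; rewrite A8 inu3 /= => outu.
  by have -> : #|out_nbrs e A u| = 4 by lia.
have unique_in_nbr v : v \in A -> #|in_nbrs e A v| = 3 ->
    exists2 w, w \in A & in_nbrs e A w = [set v].
  move=> vA in3.
  have out4 : #|out_nbrs e A v| = 4.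
    by have := card_in_out te vA; rewrite A8 in3 /=; lia.
  have tout := traceable_out te IH vA; rewrite out4 in tout.
  have [||w [wout outw inw]] :=
      triangle_in_exchange te vA in3 (ntri v vA in3) _ tout.
  - by rewrite out4.
  - by [].
  have [wA evw] : w \in A /\ e v w by move: wout; rewrite inE => /andP.
  exists w => //; have /eqP/cards1P[u inw1] : #|in_nbrs e A w| = 1.
    (* a join at w suffices for the in-degrees 0 and 2 *)
    have := traceable_step te IH wA; have := card_in_out te wA; rewrite A8.
    move: inw (ntri w wA) outw.
    move: #|in_nbrs e A w| #|out_nbrs e A w| => a b inw nin bgt ab.
    have : b < 8 by lia.
    have ea : a = 7 - b by lia.
    have na3 : a <> 3 by move=> a3; apply: nin => //; apply: inw.
    rewrite ea; move: b {ab inw nin} bgt ea.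
    by move=> [|[|[|[|[|[|[|[|b]]]]]]]] //= _ ea _;
    rewrite /hop_bound => /ntA.
  have : v \in in_nbrs e A w by rewrite inE vA.
  by rewrite inw1 => /set1P->.
have [[v vA in3]|no3] :=
  pselect (exists2 v, v \in A & #|in_nbrs e A v| = 3); last first.
  (* all degrees in question are 1 *)
  apply: (card_low_out (tournament_transpose te) (A := A) (d := 1)) => [|u].
    by apply/subsetP => u; rewrite inE => /andP[].
  rewrite inE !in_cons in_nil orbF => /andP[uA /orP[/eqP<- //|/eqP inu3]].
  by case: no3; exists u.
have [w wA inw] := unique_in_nbr v vA in3.
have from_w u : u \in A -> u != w -> u != v -> e w u.
  move=> uA nuw nuv; case/orP: (arc_total te nuw) => // euw.
  have : u \in in_nbrs e A w by rewrite inE uA.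
  by rewrite inw inE (negPf nuv).
pose I := [set u in A | #|in_nbrs e A u| == 1] :\ w.
have leI : #|I| <= 1.
  have inI u : u \in I -> u \in A /\ in_nbrs e A u = [set w].
    rewrite !inE => /and3P[nuw uA /cards1P[t inu]]; split=> //.
    have nuv : u != v by apply: contra_eq_neq in3 => <-; rewrite inu cards1.
    have : w \in in_nbrs e A u by rewrite inE wA from_w.
    by rewrite inu => /set1P->.
  apply/card_le1_eqP => u' u u'I uI; apply/eqP; apply: contrapT => /negP nuu'.
  have [uA inu] := inI u uI; have [u'A inu'] := inI u' u'I.
  have [nuw nu'w] : u != w /\ u' != w.
    by move: uI u'I; rewrite !inE => /andP[-> _] /andP[-> _].
  case/orP: (arc_total te nuu') => arc_uu.
    have : u \in in_nbrs e A u' by rewrite inE uA.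
    by rewrite inu' inE (negPf nuw).
  have : u' \in in_nbrs e A u by rewrite inE u'A.
  by rewrite inu inE (negPf nu'w).
have /subset_leq_card : C \subset v |: (w |: I).
  apply/subsetP => u; rewrite !inE; case/andP => uA /orP[/eqP inu1|/eqP inu3].
    by rewrite uA inu1 eqxx andbT; case: (u == w); rewrite ?orbT.
  have [w' w'A inw'] := unique_in_nbr u uA inu3.
  case: (eqVneq w' w) => [ww'|nw'w].
    by move: inw'; rewrite ww' inw => /set1_inj->; rewrite eqxx.
  have nw'v : w' != v.
    by apply: contra_eq_neq in3 => <-; rewrite inw' cards1.
  have : w \in in_nbrs e A w' by rewrite inE wA from_w.
  by rewrite inw' => /set1P->; rewrite eqxx orbT.
rewrite !cardsU1 => /leq_trans; apply.
by case: (_ \notin _) (_ \notin _) => [] [] /=; lia.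
Qed.

(** If the bound fails, every vertex has its in-degree or its out-degree in
    {1, 3}, which accounts for at most 3 + 3 vertices. *)
Lemma traceable_card8 (T : finType) (e : rel T) (A : {set T}) :
  tournament e -> traceable_below e A -> #|A| = 8 -> traceable e A 4.
Proof.
move=> te IH A8; apply: contrapT => ntA.
have ntA' : ~ traceable (transpose e) A 4.
  by move=> tA; apply: ntA; apply: traceable_transpose.
have := card_in13_card8 te IH A8 ntA.
have IH' := traceable_below_transpose IH.
have := card_in13_card8 (tournament_transpose te) IH' A8 ntA'.
set C' := [set v in A | _]; set C := [set v in A | _] => leC' leC.
have /subset_leq_card : A \subset C :|: C'.
  apply/subsetP => v vA; rewrite !(inE, vA) /=.
  change (in_nbrs (transpose e) A v) with (out_nbrs e A v).
  have := traceable_step te IH vA; have := card_in_out te vA.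
  rewrite A8; move: #|in_nbrs e A v| #|out_nbrs e A v| => a b ab.
  have: b < 8 by lia.
  have -> : a = 7 - b by lia.
  by move: b {ab} => [|[|[|[|[|[|[|[|b]]]]]]]] //= _;
    rewrite /hop_bound /= => /ntA.
have := cardsUI C C'; rewrite A8; lia.
Qed.

(** * The lower bound *)

(** The excluded sums correspond to 3, 5, 7, 8 and 10 vertices.  Since
    (4 (a + b + 1) - 10) / 7 = (4 a - 10) / 7 + (4 b - 10) / 7 + 2, degrees from
    4 on need no further assumption. *)
Lemma hop_bound_join a b :
    (3 < a) && (3 < b) || (a + b < 14) && (a + b \notin [:: 2; 4; 6; 7; 9]) ->
  hop_bound (a + b).+1 <= hop_bound a + hop_bound b + (1 < a) + (1 < b).
Proof.
case/orP=> [/andP[a4 b4]|abn].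
  rewrite /hop_bound; do 3! (case: eqP => [?|_]; first by lia).
  by have [-> ->] : 1 < a /\ 1 < b; lia.
have [la lb] : a < 14 /\ b < 14 by case/andP: abn; lia.
have /allP/(_ a)/[!mem_iota]/(_ la)/allP/(_ b)/[!mem_iota]/(_ lb)/implyP :
    all (fun i => all (fun j =>
      (i + j < 14) && (i + j \notin [:: 2; 4; 6; 7; 9]) ==>
      (hop_bound (i + j).+1
         <= hop_bound i + hop_bound j + (1 < i) + (1 < j)))
      (iota 0 14)) (iota 0 14).
  by vm_compute.
by apply; rewrite abn.
Qed.

Theorem traceable_hop_bound (T : finType) (e : rel T) (A : {set T}) :
  tournament e -> traceable e A (hop_bound #|A|).
Proof.
move=> te; have [n] := ubnP #|A|; elim: n A => // n IHn A ltAn.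
have IH : traceable_below e A by move=> B ltBA; apply: IHn; lia.
have [lt4|ge4] := ltnP #|A| 4.
  apply: traceable_weaken (traceable0 te A).
  by case: #|A| lt4 => [|[|[|[|]]]].
have [A5|n5] := eqVneq #|A| 5; first by rewrite A5; apply: traceable_card5.
have [A7|n7] := eqVneq #|A| 7; first by rewrite A7; apply: traceable_card7.
have [A8|n8] := eqVneq #|A| 8; first by rewrite A8; apply: traceable_card8.
have [A10|n10] := eqVneq #|A| 10; first by rewrite A10; apply: traceable_card10.
have [v vA deg_v] : exists2 v, v \in A &
    (#|A| < 15) || (3 < #|in_nbrs e A v|) && (3 < #|out_nbrs e A v|).
  have [lt15|ge15] /= := ltnP #|A| 15.
    have /card_gt0P[v vA] : 0 < #|A| by lia.
    by exists v.
  apply: contrapT => no_mid.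
  have lowA f : tournament f -> #|[set v in A | #|out_nbrs f A v| <= 3]| <= 7.
    move=> tf; apply: (card_low_out tf (A := A) (d := 3)) => [|u].
      by apply/subsetP => u; rewrite inE => /andP[].
    by rewrite inE => /andP[].
  have := lowA _ te; have := lowA _ (tournament_transpose te).
  set C' := [set v in A | _]; set C := [set v in A | _] => leC' leC.
  have /subset_leq_card : A \subset C :|: C'.
    apply/subsetP => v vA; rewrite !(inE, vA) /=; apply: contrapT => /negP.
    rewrite negb_or -!ltnNge => /andP[out4 in4].
    by case: no_mid; exists v; rewrite // out4 andbT.
  by have := cardsUI C C'; lia.
apply: traceable_weaken (traceable_step te IH vA).
have := card_in_out te vA => ab.
have -> : #|A| = (#|in_nbrs e A v| + #|out_nbrs e A v|).+1 by lia.
apply: hop_bound_join; move: deg_v ab ge4 n5 n7 n8 n10.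
move: #|in_nbrs e A v| #|out_nbrs e A v| #|A| => a b m.
rewrite !inE; lia.
Qed.

(** * The upper bound *)

(** The blocks are {3 q, 3 q + 1, 3 q + 2}, each oriented cyclically. *)
Definition triangle_chain (n : nat) : rel 'I_n := fun i j =>
  if i %/ 3 == j %/ 3 then (j == i.+1 :> nat) || (i == j.+2 :> nat) else i < j.

Lemma tournament_triangle_chain n : tournament (@triangle_chain n).
Proof.
rewrite /triangle_chain; split=> [i|i j]; first by rewrite eqxx; lia.
rewrite -val_eqE /= [j %/ 3 == _]eq_sym => nij.
case: eqP => [?|nb]; last by case: ltngtP nij.
by apply/addbP; apply/idP/idP; lia.
Qed.

Lemma triangle_chain_not_hop n (x y z : 'I_n) :
    triangle_chain x y -> triangle_chain y z -> x %/ 3 = z %/ 3 ->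
  ~~ triangle_chain x z.
Proof.
rewrite /triangle_chain => + + xz; rewrite -!xz eqxx.
case: (x %/ 3 =P y %/ 3) => [<-|nxy]; rewrite ?eqxx; first by lia.
case: eqP => [?|_]; first by lia.
move=> ltxy ltyz; suff: x %/ 3 = y %/ 3 by [].
by apply/eqP; rewrite eqn_leq leq_div2r ?(ltnW ltxy) //= xz leq_div2r // ltnW.
Qed.

(** The block index never decreases along an arc. *)
Lemma hamiltonian_triangle_chain_blocks n (s : seq 'I_n) :
  hamiltonian_path (@triangle_chain n) s ->
  [seq val i %/ 3 | i <- s] = [seq i %/ 3 | i <- iota 0 n].
Proof.
case=> ss us sA; have ps : perm_eq s (enum 'I_n).
  by apply: uniq_perm; rewrite ?enum_uniq // => i; rewrite mem_enum sA.
apply: (sorted_eq leq_trans anti_leq).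
- rewrite sorted_map; apply: sub_sorted ss => i j; rewrite /triangle_chain /=.
  by case: eqP => [->|_ /ltnW/leq_div2r->].
- rewrite sorted_map; apply: sub_sorted (iota_ltn_sorted 0 n) => i j /=.
  by move=> /ltnW/leq_div2r->.
rewrite -val_enum_ord -[in X in perm_eq _ X]map_comp; exact: perm_map.
Qed.

Lemma sum_multiples3 m : \sum_(0 <= i < m) (3 %| i) = m.+2 %/ 3.
Proof.
elim: m => [|m IHm]; first by rewrite big_nil.
by rewrite big_nat_recr //= IHm; lia.
Qed.

(** The vertex at position k of a Hamiltonian path lies in block k %/ 3, so the
    n - 2 possible hops fail at the positions 3 q with 3 q + 2 < n, of which
    there are n %/ 3. *)
Lemma hops_triangle_chain n (s : seq 'I_n) :
  1 < n -> hamiltonian_path (@triangle_chain n) s ->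
  hops (@triangle_chain n) s <= n - 2 - n %/ 3.
Proof.
move=> n2 hs; have [ss us sA] := hs.
have sz : size s = n.
  by rewrite -(card_uniqP us) -[RHS]card_ord; apply: eq_card.
have block k : k < n -> forall x0, nth x0 s k %/ 3 = k %/ 3.
  move=> ltkn x0.
  have /(congr1 (nth 0 ^~ k)) := hamiltonian_triangle_chain_blocks hs.
  by rewrite (nth_map x0) ?sz // (nth_map 0) ?size_iota // nth_iota.
have x0 : 'I_n by exists 0; lia.
have szz : size (zip s (drop 2 s)) = n - 2.
  by rewrite size_zip size_drop sz; lia.
rewrite /hops -sum1_count (big_nth (x0, x0)) szz big_mkcond /=.
rewrite leq_subRL; last by lia.
have -> : n %/ 3 = \sum_(0 <= i < n - 2) (3 %| i).
  by rewrite sum_multiples3; congr (_ %/ _); lia.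
rewrite -big_split /= -[leqRHS]subn0 -[leqRHS]muln1 -[leqRHS]sum_nat_const_nat.
rewrite big_nat [leqRHS]big_nat; apply: leq_sum => i /andP[_ lti].
rewrite nth_zip_cond szz lti nth_drop /=.
case: (boolP (3 %| i)) => [d3i|_] /=; last by case: ifP.
have arc k : k.+1 < n -> triangle_chain (nth x0 s k) (nth x0 s k.+1).
  by move=> ltkn; apply: (sortedP x0 ss); rewrite sz.
rewrite (negPf (triangle_chain_not_hop (arc i _) (arc i.+1 _) _)) //; try by lia.
by rewrite !block; lia.
Qed.

Lemma hop_number_le n : 1 < n -> hop_number n <= n - 2 - n %/ 3.
Proof.
move=> n2; have [s hs le_s] :=
  hop_number_guaranteed (card_ord n) (tournament_triangle_chain n).
exact: leq_trans le_s (hops_triangle_chain n2 hs).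
Qed.

Lemma hop_number_ge n : hop_bound n <= hop_number n.
Proof.
apply: hop_number_max => T e cT te.
have [s [ss us sA] hs] := traceable_hop_bound [set: T] te.
exists s; last by rewrite -cT -cardsT.
by split=> // x; rewrite sA inE.
Qed.

(** * Both bounds *)

Import GRing.Theory Num.Theory.
Local Open Scope ring_scope.

Theorem theorem1p1 (n : nat) (n_ge4 : (4 <= n)%N) :
  (hop_number n)%:Z <= Num.ceil ((2 * n%:R - 6) / 3 : rat) /\
  (4 * n%:R - 10) / 7 <= (hop_number n)%:R :> rat.
Proof.
have := hop_number_le (ltn_trans (isT : 1 < 3)%N n_ge4).
have := hop_number_ge n.
rewrite /hop_bound gtn_eqF //; move: (hop_number n) => k lek gek.
split.
  suff : k%:Z - 1 < Num.ceil ((2 * n%:R - 6) / 3 : rat).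
    by set c := Num.ceil _; lia.
  have : (3 * k + 3 < 2 * n)%N by lia.
  rewrite ceil_gt_int -(ltr_nat rat) intrD natrD !natrM -pmulrn; lra.
have : (4 * n <= 7 * k + 10)%N by lia.
by rewrite -(ler_nat rat) natrD !natrM; lra.
Qed.
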